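(* Let $E$ be a real uniformly convex and smooth Banach space and let $K$ be a nonempty closed convex subset of $E$ with a sunny nonexpansive retraction $P:E\to K$. Let $T_1,T_2:K\to E$ be two weakly inward, nonself uniformly $L$-Lipschitzian, total asymptotically nonexpansive mappings with sequences $\{\mu_n\},\{\lambda_n\}$ and function $\phi$, such that $\sum_{n=1}^\infty \mu_n<\infty$ and $\sum_{n=1}^\infty\lambda_n<\infty$. Suppose that there exist $M,M^*>0$ such that $\phi(\kappa)\le M^*\kappa$ for all $\kappa\ge M$. Let $\{\alpha_n\}$ and $\{\beta_n\}$ be two real sequences in $[\varepsilon,1-\varepsilon]$ for some $\varepsilon\in(0,1)$. Suppose that $\{x_n\}$ is generated by $x_1\in K$ and, for $n\in\mathbb{N}$, $$x_{n+1}=(1-\alpha_n)(PT_1)^n y_n+\alpha_n (PT_2)^n y_n,\qquad y_n=(1-\beta_n)x_n+\beta_n(PT_1)^n x_n .$$ If one of the mappings $T_1$ and $T_2$ is completely continuous and $F=F(T_1)\cap F(T_2)\ne\emptyset$, then $\{x_n\}$ converges strongly to a common fixed point of $T_1$ and $T_2$.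
   Context: A nonexpansive retraction $P:E\to K$ of $E$ onto $K$ is a nonexpansive map ($\|Px-Py\|\le\|x-y\|$) with $Px=x$ for all $x\in K$; it is sunny if $P(Px+t(x-Px))=Px$ for all $x\in E$ and all $t\ge0$. For $T:K\to E$, $PT:K\to K$ is the composition $x\mapsto P(Tx)$ and $(PT)^n$ is its $n$-th iterate ($(PT)^0$ is the identity). Fixed point sets: $F(T)=\{x\in K: Tx=x\}$. $E$ is smooth if $\lim_{t\to0}\frac{\|x+ty\|-\|x\|}{t}$ exists for all $x,y$ with $\|x\|=\|y\|=1$. A nonself mapping $T:K\to E$ is called total asymptotically nonexpansive (with sequences $\{\mu_n\},\{\lambda_n\}$ and function $\phi$) if $\{\mu_n\},\{\lambda_n\}$ are nonnegative real sequences with $\mu_n,\lambda_n\to0$ as $n\to\infty$, $\phi:\mathbb{R}\to\mathbb{R}$ is a strictly increasing continuous function with $\phi(0)=0$, and $$\|(PT)^n x-(PT)^n y\|\le \|x-y\|+\mu_n\phi(\|x-y\|)+\lambda_n\quad\text{for all }x,y\in K,\ n\ge1.$$ When two mappings $T_1,T_2$ are considered, both satisfy this inequality with the same $\{\mu_n\},\{\lambda_n\},\phi$. $T:K\to E$ is uniformly $L$-Lipschitzian if there is a constant $L>0$ such that $\|T(PT)^{n-1}x-T(PT)^{n-1}y\|\le L\|x-y\|$ for all $x,y\in K$, $n\ge1$. $T:K\to E$ is weakly inward if for every $x\in K$, $Tx$ belongs to the closure of $I_K(x)=\{x+\lambda(u-x):u\in K,\ \lambda\ge1\}$. $T$ is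 completely continuous if for every bounded sequence $\{z_n\}$ in $K$ there is a subsequence $\{z_{n_j}\}$ such that $\{Tz_{n_j}\}$ converges to some element of the range of $T$. *)

(* Defs.v *)
From HB Require Import structures.
From mathcomp Require Import all_boot all_order all_algebra.
From mathcomp Require Import all_classical all_reals all_analysis.

Set Implicit Arguments.
Unset Strict Implicit.
Unset Printing Implicit Defensive.

Import Order.TTheory GRing.Theory Num.Theory.
Import numFieldNormedType.Exports.

Local Open Scope classical_set_scope.
Local Open Scope ring_scope.

(* MathComp-Analysis.  A map K -> E (K a subset of E) is represented by a total
   function T : E -> E whose values outside K are never constrained nor used.
   Sequences of the iteration scheme are indexed from 1; their value at 0 is
   irrelevant. *)

Section spaces.
Context {R : realType}.
Implicit Type E : normedModType R.

(* Clarkson's definition, on the unit sphere. *)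
Definition uniformly_convex E : Prop :=
  forall eps : R, 0 < eps -> eps <= 2 ->
  exists delta : R, 0 < delta /\
    forall x y : E, `|x| = 1 -> `|y| = 1 -> eps <= `|x - y| ->
      `|2^-1 *: (x + y)| <= 1 - delta.

Definition smooth E : Prop :=
  forall x y : E, `|x| = 1 -> `|y| = 1 ->
    cvg ((fun t : R => (`|x + t *: y| - `|x|) / t) @ 0^').

End spaces.

Section mappings.
Context {R : realType} {E : normedModType R}.
Implicit Types (K : set E) (P T : E -> E).

Definition nonexpansive_retraction K P : Prop :=
  [/\ forall x, K (P x),
      forall x, K x -> P x = x &
      forall x y, `|P x - P y| <= `|x - y|].

Definition sunny P : Prop :=
  forall x (t : R), 0 <= t -> P (P x + t *: (x - P x)) = P x.

Definition fixed_points K T : set E := [set x | K x /\ T x = x].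

Definition PT_iter P T (n : nat) : E -> E := iter n (P \o T).

Definition total_asymptotically_nonexpansive K P
    (mu lambda : nat -> R) (phi : R -> R) T : Prop :=
  [/\ forall n, (1 <= n)%N -> 0 <= mu n /\ 0 <= lambda n,
      mu @ \oo --> (0 : R) /\ lambda @ \oo --> (0 : R),
      [/\ {homo phi : s t / s < t}, continuous phi & phi 0 = 0] &
      forall x y n, K x -> K y -> (1 <= n)%N ->
        `|PT_iter P T n x - PT_iter P T n y|
          <= `|x - y| + mu n * phi `|x - y| + lambda n].

Definition uniformly_lipschitzian K P (L : R) T : Prop :=
  0 < L /\
  forall x y n, K x -> K y -> (1 <= n)%N ->
    `|T (PT_iter P T n.-1 x) - T (PT_iter P T n.-1 y)| <= L * `|x - y|.

Definition inward_set K (x : E) : set E :=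
  [set z | exists u (l : R), [/\ K u, 1 <= l & z = x + l *: (u - x)]].

Definition weakly_inward K T : Prop :=
  forall x, K x -> closure (inward_set K x) (T x).

Definition completely_continuous K T : Prop :=
  forall z : nat -> E, (forall n, K (z n)) -> bounded_fun z ->
  exists j : nat -> nat, increasing_seq j /\
    exists w, (T @` K) w /\ (T \o z \o j) @ \oo --> w.

End mappings.

Arguments uniformly_convex {R} E.
Arguments smooth {R} E.

(* Main.v *)
Require Import Defs.
From HB Require Import structures.
From mathcomp Require Import all_boot all_order all_algebra.
From mathcomp Require Import all_classical all_reals all_analysis.
From mathcomp Require Import ring lra.

Set Implicit Arguments.
Unset Strict Implicit.
Unset Printing Implicit Defensive.

Import Order.TTheory GRing.Theory Num.Theory.
Import numFieldNormedType.Exports.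

Local Open Scope classical_set_scope.
Local Open Scope ring_scope.

(* For a common fixed point p, the perturbation terms mu_n phi(|z - p|) and
   lambda_n are summable along the iteration, so |x_n - p| converges.  Uniform
   convexity then forces (PT1)^n y_n - (PT2)^n y_n and x_n - (PT1)^n x_n to tend
   to 0, since both are differences of vectors whose norms are asymptotically
   at most lim |x_n - p| while the norms of their convex combinations attain
   this limit.  The Lipschitz condition turns this into x_n - P T_i x_n -> 0,
   and complete continuity gives a cluster point q with P T_i q = q, whence
   x_n -> q because |x_n - q| converges as soon as q is a common fixed point.

   That P T q = q implies T q = q is seen as follows: sunniness and
   nonexpansiveness give |v - q| <= |v - T q| for every v in the inward set of
   q, and v may be taken arbitrarily close to T q. *)

(** * Uniform convexity beyond the unit sphere and midpoints *)

Section uniform_convexity.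
Context {R : realType} {E : normedModType R}.
Implicit Types (u v : E) (eps eta t : R).

Lemma dist_normalized u : u != 0 -> `|u - `|u|^-1 *: u| = `|1 - `|u| |.
Proof.
move=> u0; have nu0 : `|u| != 0 by rewrite normr_eq0.
rewrite -{1}[u]scale1r -scalerBl normrZ -{2}[`|u|]normr_id -normrM.
by rewrite mulrBl mulVf// mul1r distrC.
Qed.

(** If one vector has norm below [1 - c], the triangle inequality already shortens the midpoint.
    Otherwise both vectors lie within [c] of their normalizations, to which the definition on the
    sphere applies. *)
Lemma uniformly_convex_ball eta : uniformly_convex E -> 0 < eta ->
  exists2 delta : R, 0 < delta &
    forall u v, `|u| <= 1 -> `|v| <= 1 -> eta <= `|u - v| ->
      `|2^-1 *: (u + v)| <= 1 - delta.
Proof.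
move=> ucE eta0.
have [||d [d0 dP]] := ucE (Num.min (eta / 2) 2).
- by rewrite lt_min ltr0n andbT divr_gt0.
- by rewrite ge_min lexx orbT.
(* The three bounds keep both norms positive near the sphere, keep the normalized vectors [eta / 2]
   apart, and leave part of the gain [d] after an error [c]. *)
pose c := Num.min (2^-1) (Num.min (eta / 4) (d / 2)).
have c0 : 0 < c by rewrite !lt_min invr_gt0 ltr0n/= !divr_gt0.
have c_half : c <= 2^-1 by rewrite ge_min lexx.
have c_eta : c <= eta / 4 by rewrite !ge_min lexx /= orbT.
have c_d : c <= d / 2 by rewrite !ge_min lexx /= !orbT.
exists (c / 2); first by rewrite divr_gt0.
move=> u v u1 v1 uv.
have half : `|2^-1 *: (u + v)| <= (`|u| + `|v|) / 2.
  by rewrite normrZ ger0_norm ?invr_ge0// mulrC ler_wpM2r ?invr_ge0// ler_normD.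
have [uc|uc] := ltP `|u| (1 - c); first by lra.
have [vc|vc] := ltP `|v| (1 - c); first by lra.
have u0 : u != 0 by rewrite -normr_gt0; lra.
have v0 : v != 0 by rewrite -normr_gt0; lra.
have nu0 : `|u| != 0 by rewrite normr_eq0.
have nv0 : `|v| != 0 by rewrite normr_eq0.
pose u' := `|u|^-1 *: u; pose v' := `|v|^-1 *: v.
have nu' : `|u'| = 1 by rewrite normrZ normfV normr_id mulVf.
have nv' : `|v'| = 1 by rewrite normrZ normfV normr_id mulVf.
have du : `|u - u'| <= c by rewrite dist_normalized// ger0_norm; lra.
have dv : `|v - v'| <= c by rewrite dist_normalized// ger0_norm; lra.
have uv' : Num.min (eta / 2) 2 <= `|u' - v'|.
  rewrite ge_min; apply/orP; left.
  have : `|u - v| <= `|u - u'| + `|u' - v'| + `|v - v'|.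
    rewrite (distrC v) -[u - v](subrKA u') -[u' - v](subrKA v') addrA.
    by rewrite (le_trans (ler_normD _ _))// lerD2r ler_normD.
  lra.
have := dP _ _ nu' nv' uv'.
have : `|2^-1 *: (u + v)| <= `|2^-1 *: (u' + v')| + `|2^-1 *: ((u - u') + (v - v'))|.
  by rewrite (le_trans _ (ler_normD _ _))// -scalerDr addrACA !subrKC.
have : `|2^-1 *: ((u - u') + (v - v'))| <= c.
  rewrite normrZ ger0_norm ?invr_ge0//.
  have := ler_normD (u - u') (v - v'); lra.
lra.
Qed.

(** For [t <= 2^-1] the vector is a combination of [u] and the midpoint, the latter with weight
    [2 * t >= 2 * eps], and so keeps that share of the midpoint's gain. Larger [t] follow by
    exchanging [u] and [v]. *)
Lemma uniformly_convex_comb eps eta : uniformly_convex E -> 0 < eps -> 0 < eta ->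
  exists2 delta : R, 0 < delta &
    forall u v t, `|u| <= 1 -> `|v| <= 1 -> eps <= t <= 1 - eps ->
      eta <= `|u - v| -> `|(1 - t) *: u + t *: v| <= 1 - delta.
Proof.
move=> ucE eps0 eta0.
have [d d0 dP] := uniformly_convex_ball ucE eta0.
exists (2 * eps * d); first by rewrite !mulr_gt0.
have main u v t : `|u| <= 1 -> `|v| <= 1 -> eps <= t -> t <= 2^-1 ->
    eta <= `|u - v| -> `|(1 - t) *: u + t *: v| <= 1 - 2 * eps * d.
  move=> u1 v1 et t2 uv.
  have -> : (1 - t) *: u + t *: v = (1 - 2 * t) *: u + (2 * t) *: (2^-1 *: (u + v)).
    rewrite scalerA mulrAC divff// mul1r scalerDr addrA -scalerDl.
    by congr (_ *: _ + _); ring.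
  have := dP _ _ u1 v1 uv.
  move: (2^-1 *: (u + v)) => w w1.
  apply: (le_trans (ler_normD _ _)); rewrite !normrZ !ger0_norm; [|lra..].
  have : (1 - 2 * t) * `|u| <= 1 - 2 * t by rewrite ler_piMr//; lra.
  have : 2 * t * `|w| <= 2 * t * (1 - d) by rewrite ler_wpM2l//; lra.
  have : eps * d <= t * d by rewrite ler_wpM2r// ltW.
  lra.
move=> u v t u1 v1 /andP[et te] uv.
have [t2|t2] := leP t 2^-1; first exact: main.
rewrite addrC -{1}[t](subKr 1); apply: main => //; [lra|lra|].
by rewrite distrC.
Qed.

(** Rescaling by [r + e] brings both vectors into the unit ball, where a separation of [eta] would
    push the combination below [r - e]. For [r = 0] the triangle inequality suffices. *)
Lemma uniformly_convex_near eps eta r : uniformly_convex E ->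
  0 < eps -> 0 < eta -> 0 <= r ->
  exists2 e : R, 0 < e &
    forall u v t, `|u| <= r + e -> `|v| <= r + e -> eps <= t <= 1 - eps ->
      r - e <= `|(1 - t) *: u + t *: v| -> `|u - v| < eta.
Proof.
move=> ucE eps0 eta0; rewrite le_eqVlt => /predU1P[<-|r0].
  exists (eta / 3); first by rewrite divr_gt0.
  move=> u v t; rewrite !add0r => ue ve _ _.
  by have := ler_normB u v; lra.
have [|d d0 dP] := @uniformly_convex_comb eps (eta / (2 * r)) ucE eps0.
  by rewrite divr_gt0// mulr_gt0.
(* [e <= r] bounds the scale [r + e] by [2 * r], and [e <= r * d / 4] puts [(r + e) * (1 - d)] below
   [r - e]. *)
pose e := Num.min r (r * d / 4).
have e0 : 0 < e by rewrite lt_min r0 divr_gt0 ?mulr_gt0.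
have er : e <= r by rewrite ge_min lexx.
have ed : e <= r * d / 4 by rewrite ge_min lexx orbT.
exists e => // u v t ue ve te re; rewrite ltNge; apply/negP => uv.
pose s := r + e; have s0 : 0 < s by rewrite addr_gt0.
have sV w : `|s^-1 *: w| = `|w| / s.
  by rewrite normrZ ger0_norm ?invr_ge0 1?ltW// mulrC.
have su : `|s^-1 *: u| <= 1 by rewrite sV ler_pdivrMr// mul1r.
have sv : `|s^-1 *: v| <= 1 by rewrite sV ler_pdivrMr// mul1r.
have := dP _ _ t su sv te; rewrite -scalerBr sV.
have -> : (1 - t) *: (s^-1 *: u) + t *: (s^-1 *: v)
    = s^-1 *: ((1 - t) *: u + t *: v).
  by rewrite scalerDr !scalerA; congr (_ *: _ + _ *: _); rewrite mulrC.
rewrite sV (ler_pdivrMr _ _ s0).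
have h : eta / (2 * r) <= `|u - v| / s.
  apply: ler_pM => //; [lra|by rewrite invr_ge0; lra|].
  by rewrite lef_pV2 ?posrE /s; lra.
move=> /(_ h); rewrite /s => h2.
have : 0 < e * d by rewrite mulr_gt0.
have : 0 < r * d by rewrite mulr_gt0.
lra.
Qed.

(** Schu's lemma, with a common convergent majorant [g] in place of limsup bounds on the two
    norms. *)
Lemma cvg_dist_of_comb (u v : nat -> E) (t g : nat -> R) eps (r : R) :
  uniformly_convex E -> 0 < eps -> (forall n, eps <= t n <= 1 - eps) ->
  (forall n, `|u n| <= g n) -> (forall n, `|v n| <= g n) ->
  g @ \oo --> r ->
  (fun n => `|(1 - t n) *: u n + t n *: v n|) @ \oo --> r ->
  (fun n => `|u n - v n|) @ \oo --> (0 : R).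
Proof.
move=> ucE eps0 te ug vg gr wr.
have r0 : 0 <= r.
  by apply: (cvgr_to_ge gr); apply: nearW => n; apply: le_trans (ug n).
apply/cvgr0Pnorm_lt => eta eta0.
have [e e0 eP] := uniformly_convex_near ucE eps0 eta0 r0.
have gre : \forall n \near \oo, g n <= r + e by apply: (cvgr_le _ gr); lra.
have wre : \forall n \near \oo, r - e <= `|(1 - t n) *: u n + t n *: v n|.
  by apply: (cvgr_ge _ wr); lra.
near=> n; rewrite normr_id; apply: (eP _ _ (t n)) => //.
- by apply: (le_trans (ug n)); near: n.
- by apply: (le_trans (vg n)); near: n.
- by near: n.
Unshelve. all: by end_near. Qed.

End uniform_convexity.

(** * Scalar recurrences with summable errors *)

Section recurrences.
Context {R : realType}.
Implicit Types a b c : R ^nat.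

Lemma series_nneg_le_lim c n : (forall n, 0 <= c n) -> cvgn (series c) ->
  series c n <= limn (series c).
Proof.
move=> c0 sc; apply: nondecreasing_cvgn_le sc n.
apply/nondecreasing_seqP => m.
by rewrite seriesSr lerDl.
Qed.

(** Iterating turns the factors into the exponential of a partial sum of [b]; as this is at least 1,
    each new error [c n] can be absorbed under it. *)
Lemma recurrence_bounded a b c :
  (forall n, 0 <= a n) -> (forall n, 0 <= b n) -> (forall n, 0 <= c n) ->
  (forall n, a n.+1 <= expR (b n) * (a n + c n)) ->
  cvgn (series b) -> cvgn (series c) ->
  exists D, forall n, a n <= D.
Proof.
move=> a0 b0 c0 rec sb sc.
exists (expR (limn (series b)) * (a 0%N + limn (series c))) => n.
have : a n <= expR (series b n) * (a 0%N + series c n).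
  elim: n => [|n IH]; first by rewrite !seriesEnat /= !big_nil expR0; lra.
  apply: (le_trans (rec n)); rewrite !seriesSr (addrC _ (b n)) expRD -mulrA.
  rewrite ler_wpM2l ?expR_ge0// addrA mulrDr lerD// ler_peMl// -expR0 ler_expR.
  by rewrite seriesEnat; apply: sumr_ge0.
move=> /le_trans; apply; rewrite ler_pM ?expR_ge0//.
- by rewrite addr_ge0// seriesEnat; apply: sumr_ge0.
- by rewrite ler_expR series_nneg_le_lim.
- by rewrite lerD2l series_nneg_le_lim.
Qed.

(** Subtracting the partial sums of [c] makes [a] nonincreasing, and bounded below by minus the full
    sum. *)
Lemma recurrence_cvg a c :
  (forall n, 0 <= a n) -> (forall n, 0 <= c n) ->
  (forall n, a n.+1 <= a n + c n) ->
  cvgn (series c) -> cvgn a.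
Proof.
move=> a0 c0 rec sc.
have -> : a = (a - series c) + series c by apply/funext => n; rewrite !fctE subrK.
apply: is_cvgD => //; apply: nonincreasing_is_cvgn.
  apply/nonincreasing_seqP => n; rewrite !fctE seriesSr.
  by have := rec n; lra.
exists (- limn (series c)) => _ [n _ <-]; rewrite !fctE.
by have := series_nneg_le_lim n c0 sc; have := a0 n; lra.
Qed.

End recurrences.

(** * Convex combinations, sunny retractions and asymptotic regularity *)

Section iteration.
Context {R : realType} {E : normedModType R}.
Implicit Types (K : set E) (P T S : E -> E) (X Y : nat -> E).

Lemma norm_conv_le (u v : E) (t g : R) : 0 <= t <= 1 ->
  `|u| <= g -> `|v| <= g -> `|(1 - t) *: u + t *: v| <= g.
Proof.
move=> /andP[t0 t1] ug vg; apply: (le_trans (ler_normD _ _)).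
rewrite !normrZ !ger0_norm ?subr_ge0//.
have : (1 - t) * `|u| <= (1 - t) * g by rewrite ler_wpM2l// subr_ge0.
have : t * `|v| <= t * g by rewrite ler_wpM2l.
lra.
Qed.

Lemma conv_subr (u v p : E) (t : R) :
  (1 - t) *: u + t *: v - p = (1 - t) *: (u - p) + t *: (v - p).
Proof.
by rewrite !scalerBr addrACA -opprD -scalerDl subrK scale1r.
Qed.

Lemma conv_subl (u v : E) (t : R) : (1 - t) *: u + t *: v - u = t *: (v - u).
Proof. by rewrite conv_subr subrr scaler0 add0r. Qed.

Lemma convex_set_comb K (u v : E) (t : R) : convex_set K -> 0 <= t <= 1 ->
  K u -> K v -> K ((1 - t) *: u + t *: v).
Proof.
move=> Kc /andP[t0 t1] Ku Kv.
have := Kc v u (Itv01 t0 t1) (mem_set Kv) (mem_set Ku).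
by rewrite inE addrC.
Qed.

(** By sunniness [P] sends [x + s *: (T x - x)] to [x] for all [s >= 0], while it fixes [u].
    Nonexpansiveness at [s = l^-1], scaled by [l], gives the inequality. *)
Lemma closer_to_image K P T (x v : E) : nonexpansive_retraction K P -> sunny P ->
  P (T x) = x -> inward_set K x v -> `|v - x| <= `|v - T x|.
Proof.
move=> [_ Pid Pne] Ps PTx [u [l [Ku l1 ->]]].
have l0 : 0 < l by apply: lt_le_trans l1.
have : `|u - x| <= `|u - (x + l^-1 *: (T x - x))|.
  have lV : 0 <= l^-1 by rewrite invr_ge0 ltW.
  rewrite -{1}(Pid _ Ku) -{1}PTx -(Ps (T x) l^-1 lV) PTx; exact: Pne.
have -> : x + l *: (u - x) - x = l *: (u - x) by rewrite addrC addKr.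
have -> : x + l *: (u - x) - T x = l *: (u - (x + l^-1 *: (T x - x))).
  rewrite opprD addrA [in RHS]scalerBr scalerA divff ?gt_eqF// scale1r opprB.
  by rewrite [x + _]addrC addrA.
by rewrite !normrZ ler_pM2l// gtr0_norm.
Qed.

Lemma sunny_weakly_inward_fixed K P T (x : E) :
  nonexpansive_retraction K P -> sunny P -> weakly_inward K T ->
  K x -> P (T x) = x -> T x = x.
Proof.
move=> Pr Ps Tw Kx PTx; apply/eqP; rewrite -subr_eq0 -normr_le0.
apply/ler_addgt0Pr => e e0; rewrite add0r.
(* Half of [e], because [|T x - v|] enters twice: directly and as a bound for [|v - x|]. *)
have e20 : 0 < e / 2 by rewrite divr_gt0.
have [v [Iv]] := Tw x Kx _ (nbhsx_ballx (T x) _ e20).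
rewrite -ball_normE /= => vT.
have := closer_to_image Pr Ps PTx Iv; rewrite (distrC v (T x)).
have := ler_distD v (T x) x.
lra.
Qed.

(** [A n] and [B n] stand for the iterates of the two maps. The distances [|X n - p|] grow by at
    most [2 * d n] per step, hence converge, and [cvg_dist_of_comb] applies to both steps of the
    scheme with majorant [|X n - p| + 2 * d n]. *)
Lemma asymptotic_regularity (A B : nat -> E -> E) X Y (a b d : R ^nat)
    (eps : R) (p : E) :
  uniformly_convex E -> 0 < eps ->
  (forall n, eps <= a n <= 1 - eps) -> (forall n, eps <= b n <= 1 - eps) ->
  (forall n, Y n = (1 - b n) *: X n + b n *: A n (X n)) ->
  (forall n, X n.+1 = (1 - a n) *: A n (Y n) + a n *: B n (Y n)) ->
  (forall n, 0 <= d n) -> cvgn (series d) ->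
  (forall n, `|A n (X n) - p| <= `|X n - p| + d n) ->
  (forall n, `|A n (Y n) - p| <= `|Y n - p| + d n) ->
  (forall n, `|B n (Y n) - p| <= `|Y n - p| + d n) ->
  [/\ cvgn (fun n => `|X n - p|),
      (fun n => `|X n - A n (X n)|) @ \oo --> (0 : R) &
      (fun n => `|A n (Y n) - B n (Y n)|) @ \oo --> (0 : R)].
Proof.
move=> ucE eps0 ae be YE XE d0 sd AX AY BY.
have unit_itv t : eps <= t <= 1 - eps -> 0 <= t <= 1 by lra.
have YX n : `|Y n - p| <= `|X n - p| + d n.
  rewrite YE conv_subr; apply: norm_conv_le => //; first exact: unit_itv.
  by rewrite lerDl.
have XX n : `|X n.+1 - p| <= `|X n - p| + 2 * d n.
  have := YX n; rewrite XE conv_subr => Yn.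
  apply: norm_conv_le; first exact: unit_itv.
    by have := AY n; lra.
  by have := BY n; lra.
have Xcvg : cvgn (fun n => `|X n - p|).
  apply: (@recurrence_cvg _ _ (fun n => 2 * d n)) => //.
    by move=> n; rewrite mulr_ge0.
  exact: (@is_cvg_seriesZ _ d 2).
set r := limn (fun n => `|X n - p|).
have XScvg : (fun n => `|X n.+1 - p|) @ \oo --> r.
  by move: (Xcvg); rewrite -(cvg_shiftS (fun n => `|X n - p|)).
have dcvg : d @ \oo --> (0 : R) by exact: cvg_series_cvg_0.
have gcvg : (fun n => `|X n - p| + 2 * d n) @ \oo --> r.
  rewrite -[r]addr0 -[X in r + X](mulr0 2); apply: cvgD => //.
  exact: cvgZr.
have ABcvg : (fun n => `|A n (Y n) - B n (Y n)|) @ \oo --> (0 : R).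
  have -> : (fun n => `|A n (Y n) - B n (Y n)|)
      = (fun n => `|(A n (Y n) - p) - (B n (Y n) - p)|).
    by apply/funext => n; rewrite opprB addrA subrK.
  apply: (cvg_dist_of_comb ucE eps0 ae _ _ gcvg) => [n|n|].
  - by have := AY n; have := YX n; lra.
  - by have := BY n; have := YX n; lra.
  - by under eq_fun do rewrite -conv_subr -XE.
split => //.
have -> : (fun n => `|X n - A n (X n)|)
    = (fun n => `|(X n - p) - (A n (X n) - p)|).
  by apply/funext => n; rewrite opprB addrA subrK.
apply: (cvg_dist_of_comb ucE eps0 be _ _ gcvg) => [n|n|].
- by have := d0 n; lra.
- by have := AX n; have := d0 n; lra.
under eq_fun do rewrite -conv_subr -YE.
(* The lower bound on [|Y n - p|] goes through [X n.+1], which is within [|A n (Y n) - B n (Y n)|]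
   of [A n (Y n)]; hence that limit was proved first. *)
apply: (@squeeze_cvgr _ _ _ _
  (fun n => `|X n.+1 - p| - d n - `|A n (Y n) - B n (Y n)|)
  (fun n => `|X n - p| + d n)).
- apply: nearW => n; rewrite YX andbT.
  have /andP[a0 a1] := unit_itv _ (ae n).
  have := ler_distD (A n (Y n)) (X n.+1) p.
  have : `|X n.+1 - A n (Y n)| <= `|A n (Y n) - B n (Y n)|.
    by rewrite XE conv_subl normrZ ger0_norm// distrC ler_piMl.
  by have := AY n; lra.
- rewrite -[r]subr0 -[r - 0]subr0; by apply: cvgB => //; apply: cvgB.
- by rewrite -[r]addr0; apply: cvgD.
Qed.

End iteration.

(** * Approximate fixed points and cluster points *)

Section approximate_fixed_points.
Context {R : realType} {E : normedModType R}.
Implicit Types (K : set E) (P T S : E -> E) (X Y : nat -> E).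

(** The path from [X n.+1] to [S (X n.+1)] runs through the [n.+2]-th iterates at [X n.+1] and at
    [X n]. The latter is [S] applied to the [n.+1]-th iterate, so the Lipschitz bound for [S]
    itself, [SL] at index 0, closes the chain. *)
Lemma residual_cvg0 K S X (L : R) :
  0 <= L ->
  {homo S : z / K z} ->
  (forall n u v, K u -> K v -> `|iter n.+1 S u - iter n.+1 S v| <= L * `|u - v|) ->
  (forall n, K (X n)) ->
  (fun n => `|X n - iter n.+1 S (X n)|) @ \oo --> (0 : R) ->
  (fun n => `|X n.+1 - X n|) @ \oo --> (0 : R) ->
  (fun n => `|X n - S (X n)|) @ \oo --> (0 : R).
Proof.
move=> L0 SK SL XK res step.
have iterK n z : K z -> K (iter n S z) by move=> Kz; elim: n => //= n /SK.
have resS : (fun n => `|X n.+1 - iter n.+2 S (X n.+1)|) @ \oo --> (0 : R).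
  by move: res; rewrite -(cvg_shiftS (fun n => `|X n - iter n.+1 S (X n)|)).
rewrite -(cvg_shiftS (fun n => `|X n - S (X n)|)).
apply: (@squeeze_cvgr _ _ _ _ (fun=> 0)
  (fun n => `|X n.+1 - iter n.+2 S (X n.+1)| +
     (L * `|X n.+1 - X n| +
      L * (`|X n - iter n.+1 S (X n)| + `|X n.+1 - X n|)))).
- apply: nearW => n; rewrite normr_ge0 andTb.
  apply: (le_trans (ler_distD (iter n.+2 S (X n.+1)) _ _)); rewrite lerD2l.
  apply: (le_trans (ler_distD (iter n.+2 S (X n)) _ _)); rewrite lerD//.
    exact: SL.
  apply: (le_trans (SL 0%N _ _ (iterK n.+1 _ (XK n)) (XK n.+1))).
  by rewrite ler_wpM2l// [leRHS]addrC distrC ler_distD.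
- exact: cvg_cst.
- rewrite -[0]addr0; apply: cvgD => //; rewrite -[0]addr0; apply: cvgD.
    by rewrite -[0](mulr0 L); apply: cvgZr.
  rewrite -[0](mulr0 L); apply: cvgZr.
  by rewrite -[0]addr0; apply: cvgD.
Qed.

(** In the chain [X n], [A n (X n)], [A n (Y n)], [B n (Y n)], [B n (X n)] consecutive distances
    vanish, and [X n.+1] is close to [A n (Y n)]. *)
Lemma mixed_residual_cvg0 K (A B : nat -> E -> E) X Y (L : R) :
  0 <= L ->
  (forall n u v, K u -> K v -> `|A n u - A n v| <= L * `|u - v|) ->
  (forall n u v, K u -> K v -> `|B n u - B n v| <= L * `|u - v|) ->
  (forall n, K (X n)) -> (forall n, K (Y n)) ->
  (forall n, `|Y n - X n| <= `|X n - A n (X n)|) ->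
  (forall n, `|X n.+1 - A n (Y n)| <= `|A n (Y n) - B n (Y n)|) ->
  (fun n => `|X n - A n (X n)|) @ \oo --> (0 : R) ->
  (fun n => `|A n (Y n) - B n (Y n)|) @ \oo --> (0 : R) ->
  (fun n => `|X n.+1 - X n|) @ \oo --> (0 : R) /\
  (fun n => `|X n - B n (X n)|) @ \oo --> (0 : R).
Proof.
move=> L0 AL BL XK YK YX XA h1 h2.
have AYX n : `|A n (Y n) - A n (X n)| <= L * `|X n - A n (X n)|.
  by rewrite (le_trans (AL _ _ _ (YK n) (XK n)))// ler_wpM2l.
have BYX n : `|B n (Y n) - B n (X n)| <= L * `|X n - A n (X n)|.
  by rewrite (le_trans (BL _ _ _ (YK n) (XK n)))// ler_wpM2l.
have bound : (fun n => `|A n (Y n) - B n (Y n)| +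
    (L * `|X n - A n (X n)| + (L * `|X n - A n (X n)| + `|X n - A n (X n)|)))
    @ \oo --> (0 : R).
  have Lh1 : (fun n => L * `|X n - A n (X n)|) @ \oo --> (0 : R).
    by rewrite -[0](mulr0 L); apply: cvgZr.
  rewrite -[0]addr0; apply: cvgD => //; rewrite -[0]addr0; apply: cvgD => //.
  by rewrite -[0]addr0; apply: cvgD.
have Lh1_ge0 n : 0 <= L * `|X n - A n (X n)| by rewrite mulr_ge0.
split; apply: (squeeze_cvgr _ (cvg_cst 0) bound); apply: nearW => n;
  rewrite normr_ge0 /=.
- have := ler_distD (A n (Y n)) (X n.+1) (X n).
  have := ler_distD (A n (X n)) (A n (Y n)) (X n).
  rewrite (distrC (A n (X n)) (X n)).
  by have := XA n; have := AYX n; have := Lh1_ge0 n; lra.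
- have := ler_distD (A n (X n)) (X n) (B n (X n)).
  have := ler_distD (A n (Y n)) (A n (X n)) (B n (X n)).
  have := ler_distD (B n (Y n)) (A n (Y n)) (B n (X n)).
  rewrite (distrC (A n (X n)) (A n (Y n))).
  by have := AYX n; have := BYX n; lra.
Qed.

Lemma increasing_seq_cvg (j : nat -> nat) : increasing_seq j -> j @ \oo --> \oo.
Proof.
move=> /increasing_seqP jS.
have le_j n : (n <= j n)%N by elim: n => // n /leq_ltn_trans; apply; exact: jS.
move=> A [N _ NA]; exists N => // n /= Nn.
by apply: NA => /=; exact: leq_trans (le_j n).
Qed.

(** If [T (X (j n))] tends to [w], then [P (T (X (j n)))] tends to [P w], and the vanishing residual
    carries this over to [X (j n)]. *)
Lemma completely_continuous_cluster K P T X :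
  nonexpansive_retraction K P -> completely_continuous K T ->
  (forall n, K (X n)) -> bounded_fun X ->
  (fun n => `|X n - P (T (X n))|) @ \oo --> (0 : R) ->
  exists (j : nat -> nat) (q : E),
    [/\ K q, j @ \oo --> \oo & (fun n => `|X (j n) - q|) @ \oo --> (0 : R)].
Proof.
move=> [PK _ Pne] Tc XK Xb res.
have [j [/increasing_seq_cvg j_oo [w [_ jw]]]] := Tc X XK Xb.
exists j, (P w); split=> //.
have resj : (fun n => `|X (j n) - P (T (X (j n)))|) @ \oo --> (0 : R).
  exact: (cvg_comp j (fun n => `|X n - P (T (X n))|) j_oo res).
have TXw : (fun n => `|T (X (j n)) - w|) @ \oo --> (0 : R).
  by apply/norm_cvg0P/subr_cvg0.
apply: (@squeeze_cvgr _ _ _ _ (fun=> 0)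
  (fun n => `|X (j n) - P (T (X (j n)))| + `|T (X (j n)) - w|)).
- apply: nearW => n; rewrite normr_ge0 /=.
  by rewrite (le_trans (ler_distD (P (T (X (j n)))) _ _))// lerD2l.
- exact: cvg_cst.
- by rewrite -[0]addr0; apply: cvgD.
Qed.

Lemma cluster_fixed K S X (j : nat -> nat) (q : E) (L : R) :
  (forall u v, K u -> K v -> `|S u - S v| <= L * `|u - v|) ->
  (forall n, K (X n)) -> K q -> j @ \oo --> \oo ->
  (fun n => `|X (j n) - q|) @ \oo --> (0 : R) ->
  (fun n => `|X n - S (X n)|) @ \oo --> (0 : R) ->
  S q = q.
Proof.
move=> SL XK Kq j_oo Xq res.
have resj : (fun n => `|X (j n) - S (X (j n))|) @ \oo --> (0 : R).
  exact: (cvg_comp j (fun n => `|X n - S (X n)|) j_oo res).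
apply/eqP; rewrite -subr_eq0 -normr_le0.
have bound : (fun n => L * `|X (j n) - q| + (`|X (j n) - S (X (j n))| +
    `|X (j n) - q|)) @ \oo --> (0 : R).
  rewrite -[0]addr0; apply: cvgD.
    by rewrite -[0](mulr0 L); apply: cvgZr.
  by rewrite -[0]addr0; apply: cvgD.
apply: (cvgr_to_ge bound); apply: nearW => n.
have := SL _ _ (XK (j n)) Kq.
have := ler_distD (S (X (j n))) (S q) q.
have := ler_distD (X (j n)) (S (X (j n))) q.
rewrite (distrC (S (X (j n))) (X (j n))) (distrC (S q) (S _)).
lra.
Qed.

End approximate_fixed_points.

(** * From relative to additive summable errors *)

Section summable_perturbation.
Context {R : realType} {E : normedModType R}.

(** The error [Ms * m n * |z - p|] depends on the iterates. Once [X] and [Y] are known to be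
    bounded, it becomes the additive summable error that [asymptotic_regularity] expects. *)
Lemma perturbed_iteration_regular (K : set E) (A B : nat -> E -> E)
    (X Y : nat -> E) (a b m l : R ^nat) (eps Ms C : R) (p : E) :
  uniformly_convex E -> 0 < eps ->
  (forall n, eps <= a n <= 1 - eps) -> (forall n, eps <= b n <= 1 - eps) ->
  (forall n, Y n = (1 - b n) *: X n + b n *: A n (X n)) ->
  (forall n, X n.+1 = (1 - a n) *: A n (Y n) + a n *: B n (Y n)) ->
  (forall n, K (X n)) -> (forall n, K (Y n)) ->
  0 <= Ms -> 0 <= C -> (forall n, 0 <= m n) -> (forall n, 0 <= l n) ->
  cvgn (series m) -> cvgn (series l) ->
  (forall n z, K z ->
     `|A n z - p| <= (1 + Ms * m n) * `|z - p| + (C * m n + l n)) ->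
  (forall n z, K z ->
     `|B n z - p| <= (1 + Ms * m n) * `|z - p| + (C * m n + l n)) ->
  [/\ bounded_fun X, cvgn (fun n => `|X n - p|),
      (fun n => `|X n - A n (X n)|) @ \oo --> (0 : R) &
      (fun n => `|A n (Y n) - B n (Y n)|) @ \oo --> (0 : R)].
Proof.
move=> ucE eps0 ae be YE XE XK YK Ms0 C0 m0 l0 sm sl A_le B_le.
have unit_itv (t : R) : eps <= t <= 1 - eps -> 0 <= t <= 1 by lra.
pose c n := C * m n + l n.
have c0 n : 0 <= c n by rewrite addr_ge0// mulr_ge0.
have sc : cvgn (series c).
  exact: is_cvg_seriesD (is_cvg_seriesZ (k := C) sm) sl.
have Mm0 n : 0 <= Ms * m n by rewrite mulr_ge0.
have Yle n : `|Y n - p| <= (1 + Ms * m n) * `|X n - p| + c n.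
  rewrite YE conv_subr; apply: norm_conv_le; first exact: unit_itv.
    by rewrite mulrDl mul1r -addrA lerDl addr_ge0// mulr_ge0.
  exact: A_le.
have Xle n : `|X n.+1 - p| <= (1 + Ms * m n) * `|Y n - p| + c n.
  rewrite XE conv_subr; apply: norm_conv_le; first exact: unit_itv.
    exact: A_le.
  exact: B_le.
have [DX XD] : exists D, forall n, `|X n - p| <= D.
  (* The factor [1 + Ms * m n <= expR (Ms * m n)] occurs twice, for [Y n] and for [X n.+1], and each
     occurrence adds one [c n]. *)
  apply: (@recurrence_bounded _ _ (fun n => 2 * Ms * m n) (fun n => 2 * c n)) => //.
  - by move=> n; rewrite -mulrA mulr_ge0.
  - by move=> n; rewrite mulr_ge0.
  - move=> n; apply: (le_trans (Xle n)).
    have h1 := expR_ge1Dx (Ms * m n).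
    have -> : 2 * Ms * m n = Ms * m n + Ms * m n by ring.
    rewrite expRD.
    set e := expR (Ms * m n) in h1 *.
    have e1 : 1 <= e by have := Mm0 n; lra.
    apply: (@le_trans _ _ (e * (e * `|X n - p| + c n) + c n)).
      rewrite lerD2r ler_pM//; first by rewrite addr_ge0.
      by apply: (le_trans (Yle n)); rewrite lerD2r ler_wpM2r.
    have : e * c n <= e * e * c n.
      by rewrite -mulrA ler_peMl// mulr_ge0//; lra.
    have : c n <= e * c n by rewrite ler_peMl.
    lra.
  - exact: (is_cvg_seriesZ (k := 2 * Ms) sm).
  - exact: (is_cvg_seriesZ (k := 2) sc).
have DX0 : 0 <= DX by apply: le_trans (XD 0%N).
have le_lim (u : R ^nat) n : (forall n, 0 <= u n) -> cvgn (series u) ->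
    u n <= limn (series u).
  move=> u0 su; apply: (le_trans _ (series_nneg_le_lim n.+1 u0 su)).
  by rewrite seriesSr lerDr seriesEnat sumr_ge0.
(* [A n] and [B n] are also evaluated at [Y n], so one bound must serve both sequences. *)
have [D [DXD YD]] : exists D, DX <= D /\ forall n, `|Y n - p| <= D.
  exists ((1 + Ms * limn (series m)) * DX + limn (series c)); split.
    rewrite mulrDl mul1r -addrA lerDl addr_ge0//.
      by rewrite mulr_ge0// mulr_ge0//; apply: le_trans (le_lim m 0%N m0 sm).
    by apply: le_trans (le_lim c 0%N c0 sc).
  move=> n; apply: (le_trans (Yle n)); rewrite lerD ?le_lim//.
  rewrite ler_pM//; first by rewrite addr_ge0.
  by rewrite lerD2l ler_wpM2l ?le_lim.
pose d n := Ms * D * m n + c n.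
have D0 : 0 <= D by apply: le_trans DXD.
have d0 n : 0 <= d n by rewrite addr_ge0// !mulr_ge0.
have sd : cvgn (series d).
  exact: is_cvg_seriesD (is_cvg_seriesZ (k := Ms * D) sm) sc.
have A_near n z : K z -> `|z - p| <= D -> `|A n z - p| <= `|z - p| + d n.
  move=> Kz zD; apply: (le_trans (A_le n z Kz)).
  have : Ms * m n * `|z - p| <= Ms * m n * D by rewrite ler_wpM2l.
  by rewrite /d /c; lra.
have B_near n z : K z -> `|z - p| <= D -> `|B n z - p| <= `|z - p| + d n.
  move=> Kz zD; apply: (le_trans (B_le n z Kz)).
  have : Ms * m n * `|z - p| <= Ms * m n * D by rewrite ler_wpM2l.
  by rewrite /d /c; lra.
have [n|n|n|Xcvg XA AB] :=
    asymptotic_regularity (p := p) ucE eps0 ae be YE XE d0 sd.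
- by apply: A_near => //; exact: le_trans DXD.
- exact: A_near.
- exact: B_near.
split=> //; exists (DX + `|p|); split; first exact: num_real.
move=> r rD n _ /=; apply/ltW; apply: le_lt_trans rD.
by rewrite -{1}[X n](subrK p) (le_trans (ler_normD _ _))// lerD2r.
Qed.

End summable_perturbation.

(** * Iterates of total asymptotically nonexpansive maps *)

Section total_asymptotic_nonexpansiveness.
Context {R : realType} {E : normedModType R}.
Implicit Types (K : set E) (P T : E -> E).

Lemma PT_iter_in K P T n (z : E) : nonexpansive_retraction K P -> K z ->
  K (PT_iter P T n z).
Proof. by move=> [PK _ _] Kz; case: n => //= n; exact: PK. Qed.

Lemma PT_iter_fixed K P T n (p : E) : nonexpansive_retraction K P ->
  fixed_points K T p -> PT_iter P T n p = p.
Proof.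
by move=> [_ Pid _] [Kp Tp]; apply: iter_fix; rewrite /= Tp Pid.
Qed.

Lemma PT_iter_lipschitz K P T (L : R) n (u v : E) :
  nonexpansive_retraction K P -> uniformly_lipschitzian K P L T ->
  K u -> K v -> `|PT_iter P T n.+1 u - PT_iter P T n.+1 v| <= L * `|u - v|.
Proof.
by move=> [_ _ Pne] [_ TL] Ku Kv; apply: (le_trans (Pne _ _)); exact: (TL _ _ n.+1).
Qed.

(** Below [M] monotonicity gives [phi M], above it the linear growth applies; the sum of the two
    nonnegative bounds covers both cases. *)
Lemma phi_affine_bound (phi : R -> R) (M Ms : R) :
  {homo phi : s t / s < t} -> phi 0 = 0 -> 0 < M -> 0 < Ms ->
  (forall kappa, M <= kappa -> phi kappa <= Ms * kappa) ->
  forall t, 0 <= t -> phi t <= Ms * t + phi M.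
Proof.
move=> /ltW_homo phi_mono phi0 M0 Ms0 phiM t t0.
have : 0 <= phi M by rewrite -phi0; apply/phi_mono/ltW.
have : 0 <= Ms * t by rewrite mulr_ge0// ltW.
by have [/phi_mono|/ltW/phiM] := leP t M; lra.
Qed.

Lemma PT_iter_near_fixed K P T (mu lambda : nat -> R) (phi : R -> R)
    (Ms C : R) (p z : E) n :
  nonexpansive_retraction K P ->
  total_asymptotically_nonexpansive K P mu lambda phi T ->
  (forall t, 0 <= t -> phi t <= Ms * t + C) ->
  fixed_points K T p -> K z ->
  `|PT_iter P T n.+1 z - p| <=
    (1 + Ms * mu n.+1) * `|z - p| + (C * mu n.+1 + lambda n.+1).
Proof.
move=> Pr [nneg _ _ tan] phi_le pfix Kz.
rewrite -{1}(PT_iter_fixed n.+1 Pr pfix).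
apply: (le_trans (tan _ _ _ Kz pfix.1 _)) => //.
have [mu0 _] := nneg n.+1 isT.
have := ler_wpM2l mu0 (phi_le _ (normr_ge0 (z - p))); lra.
Qed.

End total_asymptotic_nonexpansiveness.

(** * Strong convergence of the iteration *)

Theorem theorem2 (R : realType) (E : completeNormedModType R)
  (K : set E) (P T1 T2 : E -> E) (L : R)
  (mu lambda : nat -> R) (phi : R -> R)
  (eps : R) (alpha beta : nat -> R) (x y : nat -> E) :
  uniformly_convex E ->
  smooth E ->
  K !=set0 -> closed K -> convex_set K ->
  nonexpansive_retraction K P -> sunny P ->
  weakly_inward K T1 -> weakly_inward K T2 ->
  uniformly_lipschitzian K P L T1 -> uniformly_lipschitzian K P L T2 ->
  total_asymptotically_nonexpansive K P mu lambda phi T1 ->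
  total_asymptotically_nonexpansive K P mu lambda phi T2 ->
  cvgn (fun n => \sum_(1 <= k < n) mu k) ->
  cvgn (fun n => \sum_(1 <= k < n) lambda k) ->
  (exists M Mstar : R, [/\ 0 < M, 0 < Mstar &
     forall kappa : R, M <= kappa -> phi kappa <= Mstar * kappa]) ->
  0 < eps < 1 ->
  (forall n, (1 <= n)%N -> eps <= alpha n <= 1 - eps) ->
  (forall n, (1 <= n)%N -> eps <= beta n <= 1 - eps) ->
  K (x 1%N) ->
  (forall n, (1 <= n)%N ->
     y n = (1 - beta n) *: x n + beta n *: PT_iter P T1 n (x n)) ->
  (forall n, (1 <= n)%N ->
     x n.+1 = (1 - alpha n) *: PT_iter P T1 n (y n)
              + alpha n *: PT_iter P T2 n (y n)) ->
  completely_continuous K T1 \/ completely_continuous K T2 ->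
  (fixed_points K T1 `&` fixed_points K T2) !=set0 ->
  exists q, (fixed_points K T1 `&` fixed_points K T2) q /\ x @ \oo --> q.
Proof.
move=> ucE _ _ _ Kc Pr Ps Tw1 Tw2 TL1 TL2 Ta1 Ta2 mu_sum la_sum.
move=> [M [Ms [M0 Ms0 phiM]]] /andP[eps0 _] alphae betae Kx1 yE xE Tcc.
move=> [p [p1 p2]].
have [PK _ _] := Pr.
have [nneg _ [phi_mono _ phi0] _] := Ta1.
have phi_le := phi_affine_bound phi_mono phi0 M0 Ms0 phiM.
have phiM0 : 0 <= phi M by rewrite -phi0 ltW// phi_mono.
(* The scheme starts at 1 and the lemmas at 0, so all sequences are shifted and [A n], [B n] are
   iterates of order [n.+1]. *)
pose X n := x n.+1; pose Y n := y n.+1.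
pose A n := PT_iter P T1 n.+1; pose B n := PT_iter P T2 n.+1.
pose m n := mu n.+1; pose l n := lambda n.+1.
pose a n := alpha n.+1; pose b n := beta n.+1.
have m0 n : 0 <= m n by have [] := nneg n.+1 isT.
have l0 n : 0 <= l n by have [] := nneg n.+1 isT.
have series_shift (u : R ^nat) : cvgn (fun n => \sum_(1 <= k < n) u k) ->
    cvgn (series (fun n => u n.+1)).
  have -> : series (fun n => u n.+1) = (fun n => \sum_(1 <= k < n.+1) u k).
    by apply/funext => n; rewrite seriesEnat /= big_add1.
  move=> /cvg_ex[s su]; apply/cvg_ex; exists s.
  by move: su; rewrite -(cvg_shiftS (fun n => \sum_(1 <= k < n) u k)).
have sm : cvgn (series m) by exact: series_shift.
have sl : cvgn (series l) by exact: series_shift.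
have ae n : eps <= a n <= 1 - eps by exact: alphae.
have be n : eps <= b n <= 1 - eps by exact: betae.
have unit_itv (t : R) : eps <= t <= 1 - eps -> 0 <= t <= 1 by lra.
have YE n : Y n = (1 - b n) *: X n + b n *: A n (X n) by exact: yE.
have XE n : X n.+1 = (1 - a n) *: A n (Y n) + a n *: B n (Y n) by exact: xE.
have YK_of n : K (X n) -> K (Y n).
  move=> Xn; rewrite YE; apply: convex_set_comb => //; first exact: unit_itv.
  exact: PT_iter_in.
have XK n : K (X n).
  elim: n => // n /YK_of Yn; rewrite XE; apply: convex_set_comb => //.
  - exact: unit_itv.
  - exact: PT_iter_in.
  - exact: PT_iter_in.
have YK n : K (Y n) by exact: YK_of.
(* Kept general in [z]: used at the given [p] first, then at the cluster point [q]. *)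
have core z : fixed_points K T1 z -> fixed_points K T2 z ->
    [/\ bounded_fun X, cvgn (fun n => `|X n - z|),
      (fun n => `|X n - A n (X n)|) @ \oo --> (0 : R) &
      (fun n => `|A n (Y n) - B n (Y n)|) @ \oo --> (0 : R)].
  move=> fix1 fix2.
  apply: (perturbed_iteration_regular ucE eps0 ae be YE XE XK YK (ltW Ms0)
    phiM0 m0 l0 sm sl) => n u Ku.
    exact: PT_iter_near_fixed Pr Ta1 phi_le fix1 Ku.
  exact: PT_iter_near_fixed Pr Ta2 phi_le fix2 Ku.
have [Xb _ XA AB] := core p p1 p2.
have [Lpos _] := TL1; have L0 := ltW Lpos.
have AL n u v : K u -> K v -> `|A n u - A n v| <= L * `|u - v|.
  exact: PT_iter_lipschitz.
have BL n u v : K u -> K v -> `|B n u - B n v| <= L * `|u - v|.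
  exact: PT_iter_lipschitz.
have [||step XB] := mixed_residual_cvg0 L0 AL BL XK YK _ _ XA AB.
- move=> n; have /andP[b0 b1] := unit_itv _ (be n).
  by rewrite YE conv_subl normrZ ger0_norm// distrC ler_piMl.
- move=> n; have /andP[a0 a1] := unit_itv _ (ae n).
  by rewrite XE conv_subl normrZ ger0_norm// distrC ler_piMl.
have PTK T : {homo P \o T : z / K z} by move=> z _; exact: PK.
have res1 := residual_cvg0 L0 (PTK T1) AL XK XA step.
have res2 := residual_cvg0 L0 (PTK T2) BL XK XB step.
have [j [q [Kq j_oo Xq]]] : exists (j : nat -> nat) (q : E),
    [/\ K q, j @ \oo --> \oo & (fun n => `|X (j n) - q|) @ \oo --> (0 : R)].
  by case: Tcc => Tcc; apply: (completely_continuous_cluster Pr Tcc XK Xb).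
have q1 : fixed_points K T1 q.
  split=> //; apply: (sunny_weakly_inward_fixed Pr Ps Tw1) => //.
  exact: (cluster_fixed (AL 0%N) XK Kq j_oo Xq res1).
have q2 : fixed_points K T2 q.
  split=> //; apply: (sunny_weakly_inward_fixed Pr Ps Tw2) => //.
  exact: (cluster_fixed (BL 0%N) XK Kq j_oo Xq res2).
exists q; split=> //.
have [_ Xcvg _ _] := core q q1 q2.
(* The whole sequence of distances converges, so its limit can be read off along [j]. *)
have lim0 : limn (fun n => `|X n - q|) = 0.
  apply: (cvg_unique _ _ Xq); first exact: Rhausdorff.
  exact: (cvg_comp j (fun n => `|X n - q|) j_oo Xcvg).
rewrite -(cvg_shiftS x); apply/subr_cvg0/norm_cvg0P.
by move: Xcvg; rewrite lim0.
Qed.
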